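(* Let $V$ be a stochastic valuation. Then the map $\widehat V : L\to\mathbb R$ given by $\widehat V(\alpha)=\mathrm{Prob}_V(\alpha)$ is a probability assignment, i.e. for all $\alpha,\beta\in L$: (P1) $0\le \widehat V(\alpha)\le 1$; (P2) if $\vDash_c\alpha$ then $\widehat V(\alpha)=1$; (P3) if $\alpha\vDash_c\beta$ then $\widehat V(\alpha)\le\widehat V(\beta)$; (P4) if $\vDash_c\neg(\beta\wedge\alpha)$ then $\widehat V(\beta\vee\alpha)=\widehat V(\beta)+\widehat V(\alpha)$.
   Context: $B=\{B_j: j\in\mathbb N\}$ is a denumerable set of propositional symbols and $L$ is the set of propositional formulas generated from $B$ by the connectives $\neg$ and $\supset$; the other connectives, verum and falsum are the usual abbreviations. A valuation is a map $v:B\to\{0,1\}$, identified with the subset $\{B_j: v(B_j)=1\}$ of $B$. $v\Vdash_c\alpha$ denotes classical satisfaction; $\Delta\vDash_c\alpha$ means that every valuation satisfying all $\delta\in\Delta$ satisfies $\alpha$. $B_\alpha$ is the (finite, non-empty) set of symbols occurring in $\alpha$, and $[\![\alpha]\!]=\{v\cap B_\alpha : v\Vdash_c\alpha\}$. A stochastic valuation $V$ is a family $\{V_{B_j}\}_{B_j\in B}$ of random variables on a probability space $(\Omega,\mathcal F,\mu)$, where $V_{B_j}$ takes values in $\{\emptyset,\{B_j\}\}$ ($\emptyset$ standing for $0$/false, $\{B_j\}$ for $1$/true). For finite non-empty $A\subseteq B$ and $U\subseteq A$, $\mathrm{Prob}(V_A=U)=\mu\big(\bigcap_{B_j\in A}V_{B_j}^{-1}(U\cap\{B_j\})\big)$.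 For $\alpha\in L$, $\mathrm{Prob}_V(\alpha)=\sum_{U\in[\![\alpha]\!]}\mathrm{Prob}(V_{B_\alpha}=U)$. *)

(* Defs.v *)
From mathcomp Require Import all_boot all_order all_algebra finmap.
From mathcomp Require Import all_classical all_reals all_analysis.

Set Implicit Arguments.
Unset Strict Implicit.
Unset Printing Implicit Defensive.

Local Open Scope classical_set_scope.
Local Open Scope ring_scope.

(* [PVar j] is the propositional symbol B_j; throughout, B_j is represented by
   its index j, so that sets of symbols are sets of natural numbers. *)
Inductive pform : Type :=
| PVar of nat
| PNeg of pform
| PImp of pform & pform.

Definition POr (a b : pform) : pform := PImp (PNeg a) b.
Definition PAnd (a b : pform) : pform := PNeg (PImp a (PNeg b)).

Definition valuation : Type := nat -> bool.

Fixpoint sat (v : valuation) (a : pform) : bool :=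
  match a with
  | PVar j => v j
  | PNeg b => ~~ sat v b
  | PImp b c => sat v b ==> sat v c
  end.

Definition entails (D : set pform) (a : pform) : Prop :=
  forall v : valuation, (forall d, D d -> sat v d) -> sat v a.

Definition valid (a : pform) : Prop := entails set0 a.

Fixpoint symbols (a : pform) : {fset nat} :=
  match a with
  | PVar j => [fset j]%fset
  | PNeg b => symbols b
  | PImp b c => (symbols b `|` symbols c)%fset
  end.

Definition restrict_val (v : valuation) (A : {fset nat}) : {fset nat} :=
  [fset j in A | v j]%fset.

Definition models (a : pform) : set {fset nat} :=
  [set restrict_val v (symbols a) | v in [set v : valuation | sat v a]].

(* The value {B_j} of the random variable V_{B_j} is [true], its value the
   empty set is [false]. No joint law or independence is assumed. *)
Definition stochastic_valuation d (Omega : measurableType d) (R : realType)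
    (mu : probability Omega R) : Type :=
  nat -> {RV mu >-> bool}.

Section prob.
Context d (Omega : measurableType d) (R : realType) (mu : probability Omega R).
Implicit Types V : stochastic_valuation mu.

(* Prob(V_A = U), for U a subset of A. Under the encoding above, the value
   of V_{B_j} given by the intersection of U with {B_j} is [j \in U]. *)
Definition joint_prob V (A U : {fset nat}) : R :=
  fine (mu (\bigcap_(j in [set` A]) (V j @^-1` [set j \in U]))).

(* [models a] is finite, being made of subsets of [symbols a], so this
   finitely supported sum is the sum over all of [models a]. *)
Definition prob_pform V (a : pform) : R :=
  \sum_(U \in models a) joint_prob V (symbols a) U.

End prob.

Record probability_assignment (R : realType) (f : pform -> R) : Prop := {
  pa_bounds : forall a, 0 <= f a <= 1;
  pa_valid : forall a, valid a -> f a = 1;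
  pa_mono : forall a b, entails [set a] b -> f a <= f b;
  pa_add : forall a b, valid (PNeg (PAnd b a)) -> f (POr b a) = f b + f a
}.

(* Main.v *)
Require Import Defs.
From mathcomp Require Import all_boot all_order all_algebra finmap.
From mathcomp Require Import all_classical all_reals all_analysis.

(** The events [V_A = U], for [U] ranging over the models of [a] and [A] the
    symbols of [a], partition the event that the random valuation
    [j |-> V j w] satisfies [a]. Hence the probability assigned to [a] is the
    measure of that event, and (P1)-(P4) become normalisation, monotonicity and
    additivity of the measure. *)

Import Order.TTheory GRing.Theory Num.Theory.
Local Open Scope classical_set_scope.
Local Open Scope ring_scope.

Lemma eq_sat (u v : valuation) (a : pform) :
  {in symbols a, u =1 v} -> sat u a = sat v a.
Proof.
elim: a => [j|b IHb|b IHb c IHc] /= uv.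
- by apply: uv; rewrite inE.
- by rewrite IHb.
- by rewrite IHb ?IHc // => j j_in; apply: uv; rewrite inE j_in ?orbT.
Qed.

Lemma eq_restrict_val {v : valuation} {A W : {fset nat}} :
  restrict_val v A = W -> {in A, forall j, v j = (j \in W)}.
Proof. by move=> <- j jA; rewrite !inE /= jA. Qed.

(** A witness [u] of membership may differ from [v] outside [symbols a], but satisfaction depends
    only on the symbols that occur. *)
Lemma modelsP (v : valuation) (a : pform) :
  models a (restrict_val v (symbols a)) <-> sat v a.
Proof.
split=> [[u ua uv]|va]; last by exists v.
suff <- : sat u a = sat v a by [].
apply: eq_sat => j ja.
by rewrite (eq_restrict_val uv _ ja) !inE /= ja.
Qed.

Lemma finite_models (a : pform) : finite_set (models a).
Proof.
apply: (@sub_finite_set _ _ [set` fpowerset (symbols a)]).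
  move=> _ [v _ <-] /=; rewrite fpowersetE.
  by apply/fsubsetP => j; rewrite !inE => /andP[].
exact: finite_fset.
Qed.

Section probability_of_formulas.
Context {d : measure_display} {Omega : measurableType d} {R : realType}.
Context {mu : probability Omega R} (V : stochastic_valuation mu).

Definition sample_valuation (w : Omega) : valuation := fun j => V j w.

Definition sat_event (a : pform) : set Omega :=
  [set w | sat (sample_valuation w) a].

Definition joint_event (A U : {fset nat}) : set Omega :=
  \bigcap_(j in [set` A]) (V j @^-1` [set j \in U]).

Lemma measurable_joint_event (A U : {fset nat}) : measurable (joint_event A U).
Proof.
apply: fin_bigcap_measurable; first exact: finite_fset.
by move=> j _; rewrite -[X in measurable X]setTI; exact: measurable_funP.
Qed.

(** Being a model forces [U] to lie inside [symbols a]; a set with further elements could never be a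
    restriction to those symbols. *)
Lemma joint_eventE {a : pform} {U : {fset nat}} {w : Omega} : models a U ->
  joint_event (symbols a) U w <->
  restrict_val (sample_valuation w) (symbols a) = U.
Proof.
move=> [v _ <-]; split=> [Uw|Uw j /= ja].
  apply/fsetP => j; rewrite !inE /=; have [ja|//] := boolP (j \in symbols a).
  by have /= := Uw j ja; rewrite !inE /= ja /sample_valuation => ->.
exact: eq_restrict_val Uw j ja.
Qed.

(** A sample point induces a single restriction, and it equals the index of every event containing
    that point. *)
Lemma trivIset_joint_event (a : pform) :
  trivIset (models a) (joint_event (symbols a)).
Proof.
move=> U W aU aW [w [/(joint_eventE aU) <- /(joint_eventE aW) <-]].
by [].
Qed.

Lemma sat_event_bigcup (a : pform) :
  sat_event a = \bigcup_(U in models a) joint_event (symbols a) U.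
Proof.
apply/seteqP; split=> w /=.
  move=> /modelsP aw; exists (restrict_val (sample_valuation w) (symbols a)) => //.
  exact/joint_eventE.
by move=> [U aU /(joint_eventE aU) Uw]; apply/modelsP; rewrite Uw.
Qed.

Lemma measurable_sat_event (a : pform) : measurable (sat_event a).
Proof.
rewrite sat_event_bigcup; apply: fin_bigcup_measurable.
  exact: finite_models.
by move=> U _; exact: measurable_joint_event.
Qed.

Lemma prob_pformE (a : pform) : (prob_pform V a)%:E = mu (sat_event a).
Proof.
rewrite sat_event_bigcup measure_fin_bigcup.
- rewrite /prob_pform -fsumEFin; last exact: finite_models.
  (* The [fine] in [joint_prob] loses nothing, since a probability is finite on measurable sets. *)
  apply: eq_fsbigr => U _; rewrite /joint_prob fineK //.
  by apply: fin_num_measure; exact: measurable_joint_event.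
- exact: finite_models.
- exact: trivIset_joint_event.
- by move=> U _; exact: measurable_joint_event.
Qed.

End probability_of_formulas.

Theorem theorem2p7 (d : measure_display) (Omega : measurableType d)
    (R : realType) (mu : probability Omega R) (V : stochastic_valuation mu) :
  probability_assignment (prob_pform V).
Proof.
split=> [a|a aT|a b ab|a b ab].
- rewrite -!lee_fin prob_pformE measure_ge0 probability_le1 //.
  exact: measurable_sat_event.
- apply: EFin_inj; rewrite prob_pformE -(probability_setT mu); congr (mu _).
  (* Validity has no premises, so every sample valuation satisfies [a] and its event is the whole
     space. *)
  by apply/seteqP; split=> // w _; apply: aT.
- rewrite -lee_fin !prob_pformE; apply: le_measure; rewrite ?inE;
    try exact: measurable_sat_event.
  by move=> w aw; apply: ab => _ ->.
- apply: EFin_inj; rewrite EFinD !prob_pformE -measureU;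
    try exact: measurable_sat_event.
    congr (mu _); apply/seteqP; split=> w; rewrite /sat_event /=.
      (* [POr b a] unfolds to an implication from the negation of [b]; the truth value of [b] at [w]
         decides which side of the union applies. *)
      by case: (sat _ b) => /=; [left|right].
    by case: (sat _ b) => //= -[].
  (* Disjointness: a point in both events would falsify the valid formula [PNeg (PAnd b a)]. *)
  apply/seteqP; split=> // w [bw aw].
  by have /= := ab (sample_valuation V w) (fun _ => False_ind _); rewrite bw aw.
Qed.
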